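(* Let $\kappa$ be a strongly inaccessible cardinal, let $\mathbb{A}=(A,\leq,\rightarrow,\Sigma)$ be an implicative algebra with $|A|<\kappa$, and let $\mathbf{W}=W^{\mathbb{A}}_\kappa$ be the associated implicative-valued universe. Then $\mathbf{W}\vDash \sigma$ for every axiom $\sigma$ of $\mathbf{IZF}$, i.e. for $\sigma$ equal to each of $\mathbf{Emp}$, $\mathbf{Ext}$, $\mathbf{Pair}$, $\mathbf{Union}$, $\mathbf{Pow}$, $\mathbf{Inf}$ and to each instance of the schemas $\mathbf{Sep}_\varphi$, $\mathbf{Col}_\varphi$ and $\in\text{-}\mathbf{Ind}_\varphi$.
   Context: The metatheory is $\mathbf{ZFC}$. Strongly inaccessible cardinals are uncountable. **Implicative algebras.** An implicative algebra is a 4-tuple $\mathbb{A}=(A,\leq,\rightarrow,\Sigma)$ where: (1) $(A,\leq)$ is a complete lattice; (2) $\rightarrow:A\times A\to A$ is monotone in the second and anti-monotone in the first argument, and $a\rightarrow\bigwedge_{i\in I}b_i=\bigwedge_{i\in I}(a\rightarrow b_i)$ for every $a\in A$ and every indexed family $(b_i)_{i\in I}$ in $A$; (3) $\Sigma\subseteq A$ is upward closed, contains $b$ whenever it contains $a\rightarrow b$ and $a$, and contains $\mathbf{K}:=\bigwedge_{a,b\in A}(a\rightarrow(b\rightarrow a))$ and $\mathbf{S}:=\bigwedge_{a,b,c\in A}((a\rightarrow(b\rightarrow c))\rightarrow((a\rightarrow b)\rightarrow(a\rightarrow c)))$. For $a,b\in A$ and a set-indexed family $(a_i)_{i\in I}$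 in $A$ put $a\times b:=\bigwedge_{x\in A}((a\rightarrow(b\rightarrow x))\rightarrow x)$, $a+b:=\bigwedge_{x\in A}((a\rightarrow x)\rightarrow((b\rightarrow x)\rightarrow x))$, $\forall^{\mathbb{A}}_{i\in I}a_i:=\bigwedge_{i\in I}a_i$, $\exists^{\mathbb{A}}_{i\in I}a_i:=\bigwedge_{x\in A}\big(\bigwedge_{i\in I}(a_i\rightarrow x)\rightarrow x\big)$. **The universe.** $W^{\mathbb{A}}_0=\emptyset$; $W^{\mathbb{A}}_{\beta+1}$ is the set of partial functions from $W^{\mathbb{A}}_\beta$ to $A$; $W^{\mathbb{A}}_\alpha=\bigcup_{\beta<\alpha}W^{\mathbb{A}}_\beta$ for limit $\alpha$; $\mathbf{W}:=W^{\mathbb{A}}_\kappa$. $\partial_0(\alpha)$ denotes the domain of the partial function $\alpha\in\mathbf{W}$. By simultaneous recursion on rank, define functions $\in_{\mathbf{W}},=_{\mathbf{W}}:\mathbf{W}\times\mathbf{W}\to A$ by $\alpha\in_{\mathbf{W}}\beta:=\exists^{\mathbb{A}}_{t\in\partial_0(\beta)}(\beta(t)\times (t=_{\mathbf{W}}\alpha))$, $\alpha=_{\mathbf{W}}\beta:=(\alpha\subseteq_{\mathbf{W}}\beta)\times(\beta\subseteq_{\mathbf{W}}\alpha)$, where $\alpha\subseteq_{\mathbf{W}}\beta:=\forall^{\mathbb{A}}_{t\in\partial_0(\alpha)}(\alpha(t)\rightarrow (t\in_{\mathbf{W}}\beta))$. **Interpretation.** The language of set theory has variables as its only terms and binary predicates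 $=,\in$. To each formula in context $\varphi[x_1,\dots,x_n]$ (free variables among the context) is associated $\|\varphi[x_1,\dots,x_n]\|:\mathbf{W}^n\to A$: $x_i\in x_j$ and $x_i=x_j$ are sent at $(\alpha_1,\dots,\alpha_n)$ to $\alpha_i\in_{\mathbf{W}}\alpha_j$ and $\alpha_i=_{\mathbf{W}}\alpha_j$; $\bot$ is sent to the least element of $A$; $\wedge,\vee,\rightarrow$ are interpreted pointwise by $\times,+,\rightarrow$; $\|\exists y\,\varphi[\underline{x}]\|(\underline{\alpha})=\exists^{\mathbb{A}}_{\beta\in\mathbf{W}}\|\varphi[\underline{x},y]\|(\underline{\alpha},\beta)$ and $\|\forall y\,\varphi[\underline{x}]\|(\underline{\alpha})=\forall^{\mathbb{A}}_{\beta\in\mathbf{W}}\|\varphi[\underline{x},y]\|(\underline{\alpha},\beta)$. For a sentence $\sigma$, $\mathbf{W}\vDash\sigma$ means $\|\sigma[\,]\|\in\Sigma$. **Axioms of $\mathbf{IZF}$.** Abbreviations: $\forall x\in y\,\varphi$ is $\forall x(x\in y\rightarrow\varphi)$; $\exists x\in y\,\varphi$ is $\exists x(x\in y\wedge\varphi)$; $x\subseteq y$ is $\forall z\in x\,(z\in y)$. $\mathbf{Emp}$: $\exists x\forall y\in x\,\bot$. $\mathbf{Ext}$: $\forall x\forall y(x\subseteq y\wedge y\subseteq x\rightarrow x=y)$. $\mathbf{Pair}$: $\forall x\forall y\exists z(x\in z\wedge y\in z)$. $\mathbf{Union}$: $\forall x\exists u\forall y\in x\forall z\in y(z\in u)$.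 $\mathbf{Pow}$: $\forall x\exists z\forall y(y\subseteq x\rightarrow y\in z)$. $\mathbf{Inf}$: $\exists u\big(\exists x\in u\forall y\in x\,\bot\;\wedge\;\forall x\in u\exists y\in u(x\subseteq y\wedge x\in y\wedge\forall z\in y(z\in x\vee z=x))\big)$. $\mathbf{Sep}_\varphi$: $\forall w_1\cdots\forall w_n\forall x\exists y\forall z\big(\forall z\in y(z\in x\wedge\varphi)\wedge\forall z\in x(\varphi\rightarrow z\in y)\big)$, for all formulas in context $\varphi[w_1,\dots,w_n,x,z]$. $\mathbf{Col}_\varphi$: $\forall w_1\cdots\forall w_n\forall y\big(\forall x\in y\exists z\,\varphi\rightarrow\exists u\forall x\in y\exists z\in u\,\varphi\big)$, for all formulas in context $\varphi[w_1,\dots,w_n,x,y,z]$. $\in\text{-}\mathbf{Ind}_\varphi$: $\forall w_1\cdots\forall w_n\big(\forall x(\forall y\in x\,\varphi[y/x]\rightarrow\varphi)\rightarrow\forall x\,\varphi\big)$, for all formulas in context $\varphi[w_1,\dots,w_n,x]$. *)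

(* Defs.v *)
From Stdlib Require Import Wellfounded.
From mathcomp Require Import all_boot all_order.
From mathcomp Require Import boolp classical_sets functions cardinality.

Set Implicit Arguments.
Unset Strict Implicit.
Unset Printing Implicit Defensive.

Import Order.TTheory.
Local Open Scope classical_set_scope.
Local Open Scope card_scope.

(* Sets are types (or subsets of types); a cardinal is given by the
   well-ordered type of the ordinals below it. *)

Definition card_lt T U (X : set T) (Y : set U) : Prop :=
  X #<= Y /\ ~ (Y #<= X).

Section Ordinals.
Context {d : Order.disp_t} {K : orderType d}.

Definition below (a : K) : set K := [set b | (b < a)%O].

Definition ord_zero (a : K) : Prop := below a = set0.

Definition ord_succ (b a : K) : Prop :=
  (b < a)%O /\ forall c, (c < a)%O -> (c <= b)%O.

Definition ord_limit (a : K) : Prop :=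
  ~ ord_zero a /\ ~ exists b, ord_succ b a.

End Ordinals.

Record strongly_inaccessible d (K : orderType d) : Prop := {
  si_wf : well_founded (fun a b : K => (a < b)%O);
  (* [K] is an initial ordinal, i.e. a cardinal *)
  si_initial : forall a : K, card_lt (below a) [set: K];
  si_uncountable : ~ countable [set: K];
  (* every subset of smaller cardinality is bounded, i.e. the cofinality is
     that of [K] *)
  si_regular : forall X : set K, card_lt X [set: K] ->
    exists a, X `<=` below a;
  si_strong_limit : forall X : set K, card_lt X [set: K] ->
    card_lt [set Y : set K | Y `<=` X] [set: K] }.

Definition complete_lattice d (A : porderType d) : Prop :=
  forall S : set A, supremums S !=set0 /\ infimums S !=set0.

Definition bigmeet d (A : porderType d) (cA : complete_lattice A)
  (S : set A) : A := sval (cid (cA S).2).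

(* The meet of an indexed family is the meet [bigmeet] of its range. *)
Record implicative_algebra (d : Order.disp_t) := ImplicativeAlgebra {
  ia_car :> porderType d;
  ia_complete : complete_lattice ia_car;
  ia_imp : ia_car -> ia_car -> ia_car;
  ia_imp_mono : forall a a' b b',
    (a' <= a)%O -> (b <= b')%O -> (ia_imp a b <= ia_imp a' b')%O;
  ia_imp_meet : forall (a : ia_car) (S : set ia_car),
    ia_imp a (bigmeet ia_complete S) =
    bigmeet ia_complete [set ia_imp a b | b in S];
  ia_sep : set ia_car;
  ia_sep_up : forall a b, (a <= b)%O -> ia_sep a -> ia_sep b;
  ia_sep_mp : forall a b, ia_sep (ia_imp a b) -> ia_sep a -> ia_sep b;
  ia_sep_K : ia_sep (bigmeet ia_complete
    [set c | exists a b, c = ia_imp a (ia_imp b a)]);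
  ia_sep_S : ia_sep (bigmeet ia_complete
    [set e | exists a b c,
       e = ia_imp (ia_imp a (ia_imp b c))
                  (ia_imp (ia_imp a b) (ia_imp a c))]) }.

Arguments ia_complete {d} i S.

Section Connectives.
Context {d : Order.disp_t} {A : implicative_algebra d}.
Implicit Types a b : A.

Definition ia_meet (S : set A) : A := bigmeet (ia_complete A) S.

Local Notation "a ~> b" := (ia_imp a b) (at level 55, right associativity).

Definition ia_bot : A := ia_meet setT.

Definition ia_and a b : A := ia_meet [set (a ~> b ~> x) ~> x | x in setT].

Definition ia_or a b : A :=
  ia_meet [set (a ~> x) ~> (b ~> x) ~> x | x in setT].

Definition ia_all T (I : set T) (f : T -> A) : A := ia_meet [set f i | i in I].

Definition ia_ex T (I : set T) (f : T -> A) : A :=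
  ia_meet [set ia_meet [set f i ~> x | i in I] ~> x | x in setT].

End Connectives.

(* Ambient sets: hereditary sets of pairs (t, a) with t hereditary and
   a a label in [A], all of them with at most |K| elements; they are trees
   up to bisimilarity. [graph] below is extensional ([graph_inj]), and every
   stage of the universe contains all the partial functions that it should
   ([stage_full]). *)
Section Ambient.
Context {K A : Type}.

Inductive tree := Tree (D : set K) (child : D -> tree) (label : D -> A).

Fixpoint bisim (x y : tree) : Prop :=
  let: Tree D s u := x in let: Tree E t v := y in
  (forall i, exists j, bisim (s i) (t j) /\ u i = v j) /\
  (forall j, exists i, bisim (s i) (t j) /\ u i = v j).

Definition hset := {c : set tree | exists x, c = bisim x}.

Definition hset_of (x : tree) : hset :=
  exist _ (bisim x) (ex_intro _ x erefl).

Definition graph (x : hset) : set (hset * A) :=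
  [set p | exists D s u (i : set_type D),
     sval x (@Tree D s u) /\ p = (hset_of (s i), u i)].

Definition functional (F : set (hset * A)) : Prop :=
  forall t a b, F (t, a) -> F (t, b) -> a = b.

Definition dom (F : set (hset * A)) : set hset := [set t | exists a, F (t, a)].

Lemma bisim_refl x : bisim x x.
Proof. by elim: x => D s IH u /=; split=> i; exists i; split. Qed.

Lemma bisim_sym x y : bisim x y -> bisim y x.
Proof.
elim: x y => D s IH u [E t v] /= [h1 h2]; split=> i.
  by have [j [/IH ? ?]] := h2 i; exists j.
by have [j [/IH ? ?]] := h1 i; exists j.
Qed.

Lemma bisim_trans x y z : bisim x y -> bisim y z -> bisim x z.
Proof.
elim: x y z => D s IH u [E t v] [F r w] /= [h1 h2] [g1 g2]; split=> i.
  have [j [b1 e1]] := h1 i; have [k [b2 e2]] := g1 j.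
  by exists k; split; [exact: IH b1 b2 | rewrite e1].
have [j [b2 e2]] := g2 i; have [k [b1 e1]] := h2 j.
by exists k; split; [exact: IH b1 b2 | rewrite e1].
Qed.

Lemma hset_eq (x y : hset) : sval x = sval y -> x = y.
Proof. by case: x y => [c p] [c' p'] /= e; apply: eq_exist. Qed.

Lemma hset_ofP x y : hset_of x = hset_of y <-> bisim x y.
Proof.
split=> [e|xy].
  have -> : bisim x = sval (hset_of x) by [].
  by rewrite e /=; exact: bisim_refl.
apply: hset_eq => /=; apply/funext => z; apply/propext; split.
  exact/bisim_trans/bisim_sym.
exact: bisim_trans.
Qed.

Lemma hset_ofE (x : hset) : exists y, x = hset_of y.
Proof. by case: (x) => c [y cy]; exists y; apply: hset_eq. Qed.

Lemma graph_of D s u :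
  graph (hset_of (@Tree D s u)) = [set p | exists i, p = (hset_of (s i), u i)].
Proof.
apply/seteqP; split => p /=.
  move=> [E [t [v [i [[_ /(_ i) [j [/hset_ofP b e]]] ->]]]]].
  by exists j; rewrite b e.
move=> [i ->]; exists D, s, u, i; split => //.
by split=> k; exists k; split => //; exact: bisim_refl.
Qed.

Lemma graph_inj (x y : hset) : graph x = graph y -> x = y.
Proof.
have [[D s u] ->] := hset_ofE x; have [[E t v] ->] := hset_ofE y.
rewrite !graph_of => /seteqP [h1 h2]; apply/hset_ofP; split => i.
  have [j [b e]] := h1 _ (ex_intro _ i erefl).
  by exists j; rewrite b; split => //; exact: bisim_refl.
have [j [b e]] := h2 _ (ex_intro _ i erefl).
by exists j; rewrite -b; split => //; exact: bisim_refl.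
Qed.

Lemma child_wf : well_founded (fun t x : hset => dom (graph x) t).
Proof.
move=> x; have [y ->] := hset_ofE x; elim: y => D s IH u.
by constructor => t [a]; rewrite graph_of /= => -[i [-> _]].
Qed.

End Ambient.
Arguments tree : clear implicits.
Arguments hset : clear implicits.

Section Universe.
Context {dK dA : Order.disp_t} {K : orderType dK} {A : implicative_algebra dA}.

(* [stage a] is the set W_a for the ordinal a; the missing clause for 0 makes
   W_0 empty. *)
Inductive stage : K -> set (hset K A) :=
| stage_succ b a x : ord_succ b a ->
    functional (graph x) -> (forall t, dom (graph x) t -> stage b t) ->
    stage a x
| stage_limit b a x : ord_limit a -> (b < a)%O -> stage b x -> stage a x.

End Universe.

Lemma card_leI T U (X : set T) (Y : set U) (f : T -> U) :
  (forall x, X x -> Y (f x)) ->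
  (forall x y, X x -> X y -> f x = f y -> x = y) -> X #<= Y.
Proof.
move=> fXY finj; have [|g] := (@injfunPex T U X Y).2; last exact: inj_card_le.
by exists f => // x y /set_mem Xx /set_mem Xy; exact: finj.
Qed.

Lemma card_leE T U (X : set T) (Y : set U) (u : U) : X #<= Y ->
  exists f : T -> U, (forall x, X x -> Y (f x)) /\
    (forall x y, X x -> X y -> f x = f y -> x = y).
Proof.
move=> /card_leP [g].
pose f x := if pselect (X x) is left h then val (g (SigSub (mem_set h))) else u.
exists f; split => [x Xx|x y Xx Xy].
  by rewrite /f; case: pselect => // h; exact: set_valP.
rewrite /f; case: pselect => // h; case: pselect => // h' /val_inj e.
have := @inj _ _ _ g _ _ _ _ e; rewrite !inE => /(_ I I) [].
by [].
Qed.

(* Cardinal arithmetic below [K], needed to check that the stages are full. *)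
Section Small.
Context {d : Order.disp_t} {K : orderType d} (hK : strongly_inaccessible K).

Let small T (X : set T) := card_lt X [set: K].

Lemma small_le T U (X : set T) (Y : set U) : X #<= Y -> small Y -> small X.
Proof.
move=> XY [YK nKY]; split; first exact: card_le_trans YK.
by move=> KX; apply: nKY; exact: card_le_trans XY.
Qed.

Lemma K_inhab : exists a : K, True.
Proof.
apply: contrapT => /forallNP K0; apply: (si_uncountable hK).
by apply: card_leI (fun=> 0%N) _ _ => // x; have := K0 x.
Qed.

Lemma small_below T (X : set T) : small X -> exists a : K, X #<= below a.
Proof.
move=> sX; have [k _] := K_inhab.
have [f [_ finj]] := card_leE k sX.1.
have /(si_regular hK) [a fa] : small (f @` X).
  by apply: small_le sX; exact: card_image_le.
exists a; apply: (card_leI (f := f)) => // x Xx.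
by apply: fa; exists x.
Qed.

Lemma small_image T (X : set T) : small X -> exists Y : set K,
  small Y /\ X #<= Y.
Proof.
by move=> /small_below [a Xa]; exists (below a); split => //; exact: si_initial.
Qed.

Lemma card_le_power T (X : set T) U (Y : set U) : X #<= Y ->
  [set Z | Z `<=` X] #<= [set Z | Z `<=` Y].
Proof.
move=> XY; have [[u]|nU] := pselect (exists u : U, True).
  move=> _; have [f [fXY finj]] := card_leE u XY.
  apply: (card_leI (f := fun Z => f @` Z)) => /= [Z ZX _ [x Zx <-]|Z Z' ZX Z'X e].
    exact/fXY/ZX.
  suff sub A B : A `<=` X -> B `<=` X -> f @` A = f @` B -> A `<=` B.
    by apply/seteqP; split; apply: sub.
  move=> AX BX fAB x Ax; have : (f @` B) (f x) by rewrite -fAB; exists x.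
  by move=> [y By /finj <-]; auto.
have Y0 : Y = set0 by rewrite -subset0 => y; case: nU; exists y.
move: XY; rewrite Y0 => /card_le0P ->.
apply: (card_leI (f := fun=> set0)) => [Z _ //|Z Z' /=].
by rewrite !subset0 => -> ->.
Qed.

Lemma small_power T (X : set T) : small X -> small [set Z | Z `<=` X].
Proof.
move=> /small_image [Y [sY XY]]; apply: small_le (card_le_power XY) _.
exact: si_strong_limit.
Qed.

Lemma below_le (a b : K) : (a <= b)%O -> below a `<=` below b.
Proof. by move=> ab c /= ca; exact: lt_le_trans ab. Qed.

Lemma small_prod T U (X : set T) (Y : set U) :
  small X -> small Y -> small [set p | X p.1 /\ Y p.2].
Proof.
move=> /small_below [a Xa] /small_below [b Yb].
pose c := Order.max a b; have [k _] := K_inhab.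
have Xc : X #<= below c.
  by apply: card_le_trans Xa _; apply/subset_card_le/below_le; rewrite le_max lexx.
have Yc : Y #<= below c.
  by apply: card_le_trans Yb _; apply/subset_card_le/below_le; rewrite le_max lexx orbT.
have [f [fX finj]] := card_leE k Xc; have [g [gY ginj]] := card_leE k Yc.
apply: small_le (small_power (small_power (si_initial hK c))).
apply: (card_leI (f := fun p => [set [set f p.1]; [set f p.1; g p.2]])).
  move=> [x y] [/= Xx Yy] _ /= [] -> z /=; first by move=> ->; exact: fX.
  by move=> [] ->; [exact: fX | exact: gY].
move=> [x y] [x' y'] [/= Xx Yy] [/= Xx' Yy'] e.
have fe : f x = f x'.
  have : [set [set f x]; [set f x; g y]] [set f x] by left.
  rewrite e => -[] /seteqP [_ h]; first by apply/esym/h.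
  by apply/esym/h; left.
have ge : g y = g y'.
  have h1 : [set f x; g y] (g y') \/ g y' = f x.
    have : [set [set f x]; [set f x; g y]] [set f x'; g y'].
      by rewrite e; right.
    move=> [] /seteqP [h _]; [right | left]; by apply: h; right.
  have h2 : [set f x'; g y'] (g y) \/ g y = f x'.
    have : [set [set f x']; [set f x'; g y']] [set f x; g y].
      by rewrite -e; right.
    by move=> [] /seteqP [h _]; [right | left]; apply: h; right.
  rewrite fe in h1 h2 *.
  by case: h1 => [[]|]; case: h2 => [[]|]; congruence.
by rewrite (finj _ _ Xx Xx' fe) (ginj _ _ Yy Yy' ge).
Qed.

Lemma small_union T (a : K) (X : K -> set T) :
  (forall b, (b < a)%O -> small (X b)) ->
  small [set x | exists2 b, (b < a)%O & X b x].
Proof.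
move=> sX; have [k _] := K_inhab.
have /choice [g gX] b : exists c : K, (b < a)%O -> X b #<= below c.
  have [ba|] := pselect (b < a)%O; last by exists k.
  by have [c] := small_below (sX _ ba); exists c.
have /(si_regular hK) [c gc] : small (g @` below a).
  by apply: small_le (si_initial hK a); exact: card_image_le.
have /choice [f fX] b : exists f : T -> K, (b < a)%O ->
    (forall x, X b x -> (f x < c)%O) /\
    (forall x y, X b x -> X b y -> f x = f y -> x = y).
  have [ba|] := pselect (b < a)%O; last by exists (fun=> k).
  have [f [fb finj]] := card_leE k (gX _ ba).
  exists f => _; split => // x /fb /= /lt_trans; apply.
  by apply: gc; exists b.
have /choice [r rX] x : exists b, (exists2 b, (b < a)%O & X b x) -> (b < a)%O /\ X b x.
  have [[b ? ?]|] := pselect (exists2 b, (b < a)%O & X b x); first by exists b.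
  by exists k.
apply: small_le (small_prod (si_initial hK a) (si_initial hK c)).
apply: (card_leI (f := fun x => (r x, f (r x) x))).
  by move=> x /rX [ra Xx]; split => //=; apply: (fX _ ra).1.
move=> x y /rX [ra Xx] /rX [rb Xy] [e]; rewrite -e in Xy * => /(fX _ ra).2; exact.
Qed.

Lemma graph_full A (F : set (hset K A * A)) : F #<= [set: K] ->
  exists x, graph x = F.
Proof.
move=> FK; have [k _] := K_inhab; have [f [_ finj]] := card_leE k FK.
have ex (i : f @` F) : exists p : tree K A * A,
    F (hset_of p.1, p.2) /\ f (hset_of p.1, p.2) = val i.
  have [[t a] Fta <-] := set_valP i; have [y ty] := hset_ofE t.
  by exists (y, a); rewrite -ty.
have [p pF] := choice ex.
exists (hset_of (Tree (fun i => (p i).1) (fun i => (p i).2))).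
rewrite graph_of; apply/seteqP; split => [_ [i ->]|[t a] Fta].
  by have [] := pF i.
have fi : (f @` F) (f (t, a)) by exists (t, a).
exists (SigSub (mem_set fi)); have [h1 h2] := pF (SigSub (mem_set fi)).
by apply: finj => //; rewrite h2.
Qed.

Context {dA : Order.disp_t} {A : implicative_algebra dA}.
Context (hA : small [set: A]).

Lemma stageE a (x : hset K A) : stage a x ->
  (exists b, [/\ ord_succ b a, functional (graph x) &
     forall t, dom (graph x) t -> stage b t]) \/
  (exists b, [/\ ord_limit a, (b < a)%O & stage b x]).
Proof. by case=> [b {}a {}x|b {}a {}x] *; [left|right]; exists b. Qed.

Lemma stage_small a : small (@stage _ _ K A a).
Proof.
elim/(well_founded_ind (si_wf hK)): a => a IH.
have sPA b : (b < a)%O ->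
    small [set Z | Z `<=` [set p : hset K A * A | @stage _ _ K A b p.1 /\ [set: A] p.2]].
  by move=> ba; apply/small_power/small_prod; [exact: IH|].
have s1 b : (b < a)%O -> small [set x : hset K A | forall t, dom (graph x) t -> stage b t].
  move=> ba; apply: small_le (sPA b ba).
  apply: (card_leI (f := fun x => graph x)) => [x /= xb [t c] xt|x y _ _].
    by split => //; apply: xb; exists c.
  exact: graph_inj.
have h1 := small_union s1; have h2 := small_union IH.
have [[b ab]|na] := pselect (exists b, ord_succ b a).
  apply: small_le (s1 _ ab.1); apply: subset_card_le => x /stageE.
  move=> [[b' [ab' _ xb']]|[b' [[_ []]]]]; last by exists b.
  have -> : b = b' by apply/le_anti; rewrite (ab.2 _ ab'.1) (ab'.2 _ ab.1).
  exact: xb'.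
apply: small_le h2; apply: subset_card_le => x /stageE.
by move=> [[b' [ab' _ _]]|[b' [_ ba xb]]]; [case: na|]; exists b'.
Qed.

(* W_{b+1} consists of all the partial functions from W_b to [A]. *)
Lemma stage_full a b (F : set (hset K A * A)) : ord_succ b a ->
  functional F -> dom F `<=` stage b -> exists2 x, stage a x & graph x = F.
Proof.
move=> ab Ffun Fb.
have FK : F #<= [set: K].
  apply: card_le_trans (stage_small b).1.
  apply: (card_leI (f := fst)) => [[t c] Ft|[t c] [t' c'] Ft + /= tt'].
    by apply: Fb; exists c.
  by rewrite -tt' => /(Ffun _ _ _ Ft) ->.
have [x xF] := graph_full FK.
by exists x => //; apply: stage_succ ab _ _; rewrite xF.
Qed.
End Small.

Section Names.
Context {dK dA : Order.disp_t} (K : orderType dK) (A : implicative_algebra dA).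

(* An infinite initial ordinal is a limit, so W_kappa is the union of the
   stages below kappa. *)
Definition W := {x : hset K A | exists a : K, stage a x}.

End Names.

Section Truth.
Context {dK dA : Order.disp_t} {K : orderType dK} {A : implicative_algebra dA}.
Local Notation W := (W K A).
Implicit Types x y t : W.

Definition Wdom x : set W := [set t | dom (graph (sval x)) (sval t)].

Lemma W_dom x (t : hset K A) :
  dom (graph (sval x)) t -> exists2 t' : W, sval t' = t & Wdom x t'.
Proof.
case: x => x [a xa] /= xt; suff [b tb] : exists b : K, stage b t.
  by exists (exist _ t (ex_intro _ b tb)).
by elim: xa xt => // b' a' y _ _ yb _ /yb; exists b'.
Qed.

Definition Wapp x t : A :=
  xget ia_bot [set a | graph (sval x) (sval t, a)].

Lemma Wapp_graph x t : Wdom x t -> graph (sval x) (sval t, Wapp x t).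
Proof. by move=> [a xa]; rewrite /Wapp; case: xgetP => // /(_ a). Qed.

(* The right-hand sides of the recursion clauses, the equality predicate on
   elements of smaller rank being [e]. *)
Definition mem_step (e : W -> W -> A) x y : A :=
  ia_ex (Wdom y) (fun t => ia_and (Wapp y t) (e t x)).

Definition sub_step (e : W -> W -> A) x y : A :=
  ia_all (Wdom x) (fun t => ia_imp (Wapp x t) (mem_step e t y)).

Definition eq_step (e : W -> W -> A) x y : A :=
  ia_and (sub_step e x y) (sub_step e y x).

Definition below2 (p q : W * W) : Prop :=
  (Wdom q.1 p.1 /\ Wdom q.2 p.2) \/ (Wdom q.2 p.1 /\ Wdom q.1 p.2).

Lemma Wdom_wf : well_founded (fun t x => Wdom x t).
Proof.
exact: (wf_inverse_image _ _ _ (fun x : W => sval x) child_wf).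
Qed.

Lemma below2_wf : well_founded below2.
Proof.
suff H x : forall y, Acc below2 (x, y) /\ Acc below2 (y, x).
  by move=> [x y]; have [] := H x y.
elim/(well_founded_ind Wdom_wf): x => x IH y.
by split; constructor=> -[s t] [] [/= h1 h2];
  [have [] := IH _ h1 t | have [] := IH _ h2 s
  |have [] := IH _ h2 s | have [] := IH _ h1 t].
Qed.

Definition eqW_body (p : W * W) (rec : forall q, below2 q p -> A) : A :=
  eq_step (fun s t => if pselect (below2 (s, t) p) is left h
                      then rec (s, t) h else ia_bot) p.1 p.2.

Definition eqW x y : A := Fix below2_wf (fun=> A) eqW_body (x, y).

Definition memW x y : A := mem_step eqW x y.

Definition subW x y : A := sub_step eqW x y.

Lemma eq_step_ext (e f : W -> W -> A) x y :
  (forall s t, below2 (s, t) (x, y) -> e s t = f s t) ->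
  eq_step e x y = eq_step f x y.
Proof.
move=> ef; suff sub_ext u v :
    (forall s t, Wdom v s -> Wdom u t -> e s t = f s t) ->
    sub_step e u v = sub_step f u v.
  by rewrite /eq_step (sub_ext x y) ?(sub_ext y x) // => s t vs ut;
    apply: ef; [left | right].
move=> euv; rewrite /sub_step /ia_all; congr (ia_meet _).
apply: eq_imagel => t ut; congr (ia_imp _ _).
rewrite /mem_step /ia_ex; congr (ia_meet _).
apply: eq_imagel => z _; congr (ia_imp (ia_meet _) _).
by apply: eq_imagel => s vs; rewrite euv.
Qed.

(* The recursion clauses. *)
Lemma eqWE x y : eqW x y = ia_and (subW x y) (subW y x).
Proof.
have ext p (f g : forall q, below2 q p -> A) :
    (forall q h, f q h = g q h) -> eqW_body f = eqW_body g.
  by move=> fg; congr (eqW_body _); apply: functional_extensionality_dep => q;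
    apply/funext => h.
rewrite /eqW (Fix_eq below2_wf (fun=> A) eqW_body ext) /eqW_body.
transitivity (eq_step eqW x y); last by [].
by apply: eq_step_ext => s t st; case: pselect.
Qed.

Lemma subWE x y :
  subW x y = ia_all (Wdom x) (fun t => ia_imp (Wapp x t) (memW t y)).
Proof. by []. Qed.

Lemma memWE x y :
  memW x y = ia_ex (Wdom y) (fun t => ia_and (Wapp y t) (eqW t x)).
Proof. by []. Qed.

End Truth.

(* [form n] is the type of formulas in a context of n variables, with
   de Bruijn indices: the variable 0 is the last one of the context. In the
   axioms below, the comment after a binder names the variable that it binds;
   a renaming [fscons a f] sends the variable 0 to a and i+1 to f i. *)
Inductive form : nat -> Type :=
| fMem n (i j : 'I_n) : form n
| fEq n (i j : 'I_n) : form n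
| fBot n : form n
| fAnd n (p q : form n) : form n
| fOr n (p q : form n) : form n
| fImp n (p q : form n) : form n
| fEx n (p : form n.+1) : form n
| fAll n (p : form n.+1) : form n.
Arguments fBot {n}.
Arguments fMem [n] & i j.
Arguments fEq [n] & i j.
Arguments fAnd [n] & p q.
Arguments fOr [n] & p q.
Arguments fImp [n] & p q.
Arguments fEx [n] & p.
Arguments fAll [n] & p.

Section Renaming.

Definition fscons m n (a : 'I_m) (f : 'I_n -> 'I_m) (i : 'I_n.+1) : 'I_m :=
  if unlift ord0 i is Some j then f j else a.

Definition fup m n (f : 'I_n -> 'I_m) : 'I_n.+1 -> 'I_m.+1 :=
  fscons ord0 (fun i => lift ord0 (f i)).

Fixpoint frename n (p : form n) : forall m, ('I_n -> 'I_m) -> form m :=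
  match p in form n return forall m, ('I_n -> 'I_m) -> form m with
  | fMem _ i j => fun _ f => fMem (f i) (f j)
  | fEq _ i j => fun _ f => fEq (f i) (f j)
  | fBot _ => fun _ _ => fBot
  | fAnd _ p q => fun _ f => fAnd (frename p f) (frename q f)
  | fOr _ p q => fun _ f => fOr (frename p f) (frename q f)
  | fImp _ p q => fun _ f => fImp (frename p f) (frename q f)
  | fEx _ p => fun _ f => fEx (frename p (fup f))
  | fAll _ p => fun _ f => fAll (frename p (fup f))
  end.

End Renaming.

Arguments fscons [m n] & a f i.
Arguments frename [n] p [m] & f.

Section Interpretation.
Context {dK dA : Order.disp_t} {K : orderType dK} {A : implicative_algebra dA}.

(* The tuple lists the context from its last variable to its first one. *)
Fixpoint interp n (p : form n) : n.-tuple (W K A) -> A :=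
  match p in form n return n.-tuple (W K A) -> A with
  | fMem _ i j => fun v => memW (tnth v i) (tnth v j)
  | fEq _ i j => fun v => eqW (tnth v i) (tnth v j)
  | fBot _ => fun _ => ia_bot
  | fAnd _ p q => fun v => ia_and (interp p v) (interp q v)
  | fOr _ p q => fun v => ia_or (interp p v) (interp q v)
  | fImp _ p q => fun v => ia_imp (interp p v) (interp q v)
  | fEx _ p => fun v => ia_ex setT (fun b => interp p [tuple of b :: v])
  | fAll _ p => fun v => ia_all setT (fun b => interp p [tuple of b :: v])
  end.

End Interpretation.

Definition models dK dA (K : orderType dK) (A : implicative_algebra dA)
  (s : form 0) : Prop := ia_sep (interp s ([tuple] : 0.-tuple (W K A))).

Definition fvar n k (h : (k < n)%N) : 'I_n := Ordinal h.
Arguments fvar [n] & k h.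

Local Notation "''v' k" := (fvar k isT) (at level 8, k at level 2).

Definition fball n (y : 'I_n) (p : form n.+1) : form n :=
  fAll (fImp (fMem ord0 (lift ord0 y)) p).

Arguments fball [n] & y p.

Definition fbex n (y : 'I_n) (p : form n.+1) : form n :=
  fEx (fAnd (fMem ord0 (lift ord0 y)) p).

Arguments fbex [n] & y p.

Definition fsub n (x y : 'I_n) : form n := fball x (fMem ord0 (lift ord0 y)).

Arguments fsub [n] & x y.

Fixpoint fclosure n : form n -> form 0 :=
  if n is m.+1 then fun p => fclosure (fAll p) else id.

Definition axEmp : form 0 := fEx (fball ('v 0) fBot).

Definition axExt : form 0 :=
  fAll (* x *) (fAll (* y *)
    (fImp (fAnd (fsub ('v 1) ('v 0)) (fsub ('v 0) ('v 1))) (fEq ('v 1) ('v 0)))).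

Definition axPair : form 0 :=
  fAll (* x *) (fAll (* y *) (fEx (* z *)
    (fAnd (fMem ('v 2) ('v 0)) (fMem ('v 1) ('v 0))))).

Definition axUnion : form 0 :=
  fAll (* x *) (fEx (* u *)
    (fball ('v 1) (* y *) (fball ('v 0) (* z *) (fMem ('v 0) ('v 2))))).

Definition axPow : form 0 :=
  fAll (* x *) (fEx (* z *) (fAll (* y *)
    (fImp (fsub ('v 0) ('v 2)) (fMem ('v 0) ('v 1))))).

Definition axInf : form 0 :=
  fEx (* u *) (fAnd
    (fbex ('v 0) (* x *) (fball ('v 0) fBot))
    (fball ('v 0) (* x *) (fbex ('v 1) (* y *)
      (fAnd (fsub ('v 1) ('v 0)) (fAnd (fMem ('v 1) ('v 0))
        (fball ('v 0) (* z *)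
          (fOr (fMem ('v 0) ('v 2)) (fEq ('v 0) ('v 2))))))))).

(* [p] is in context w_1, ..., w_n, x, z. The outer quantifier on z is
   vacuous, its variable being rebound in both conjuncts. *)
Definition axSep n (p : form n.+2) : form 0 :=
  fclosure (fAll (* x *) (fEx (* y *) (fAll (* z *)
    (fAnd
      (fball ('v 1) (* z *) (fAnd (fMem ('v 0) ('v 3))
        (frename p (fscons ('v 0) (fscons ('v 3) (@rshift 4 n))))))
      (fball ('v 2) (* z *) (fImp
        (frename p (fscons ('v 0) (fscons ('v 3) (@rshift 4 n))))
        (fMem ('v 0) ('v 2)))))))).

(* [p] is in context w_1, ..., w_n, x, y, z. *)
Definition axCol n (p : form n.+3) : form 0 :=
  fclosure (fAll (* y *) (fImp
    (fball ('v 0) (* x *) (fEx (* z *)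
      (frename p (fscons ('v 0) (fscons ('v 2) (fscons ('v 1) (@rshift 3 n)))))))
    (fEx (* u *) (fball ('v 1) (* x *) (fbex ('v 1) (* z *)
      (frename p
        (fscons ('v 0) (fscons ('v 3) (fscons ('v 1) (@rshift 4 n)))))))))).

(* [p] is in context w_1, ..., w_n, x. *)
Definition axInd n (p : form n.+1) : form 0 :=
  fclosure (fImp
    (fAll (* x *) (fImp
      (fball ('v 0) (* y *) (frename p (fscons ('v 0) (@rshift 2 n))))
      p))
    (fAll (* x *) p)).

Inductive IZF : form 0 -> Prop :=
| IZF_Emp : IZF axEmp
| IZF_Ext : IZF axExt
| IZF_Pair : IZF axPair
| IZF_Union : IZF axUnion
| IZF_Pow : IZF axPow
| IZF_Inf : IZF axInf
| IZF_Sep n (p : form n.+2) : IZF (axSep p)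
| IZF_Col n (p : form n.+3) : IZF (axCol p)
| IZF_Ind n (p : form n.+1) : IZF (axInd p).

(* Main.v *)
Require Import Defs.
From mathcomp Require Import all_boot all_order.
From mathcomp Require Import boolp classical_sets functions cardinality.

Set Implicit Arguments.
Unset Strict Implicit.
Unset Printing Implicit Defensive.

Import Order.TTheory.
Local Open Scope classical_set_scope.
Local Open Scope order_scope.

(** The proof is a realizability argument.  An implicative algebra carries an
    application and an abstraction, so that untyped lambda-terms denote elements
    of [A]; the denotation of a lambda-term whose constants lie in the separator
    lies in the separator.  A sentence is therefore valid as soon as some such
    term [t] satisfies [t <= phi], and these inequalities obey the typing rules
    of second-order intuitionistic logic ([lam_le], [app_le], [rpair_le],
    [pack_le], [unpack_le], ...), with universal quantifiers as intersections:
    one and the same term must work for all elements of the universe.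

    The recursion on names that defines equality is matched by the fixed point
    combinator, which gives one realizer for a whole well-founded family
    ([fixp_le]).  So equality is reflexive and transitive, membership and then
    every formula is compatible with it ([interp_subst]), uniformly in the
    names.

    On the side of the universe, every bounded set of names is the domain of a
    name with prescribed values ([name_exists]), and a set of names of cardinal
    less than [K] is bounded because [K] is regular ([bounded_small]).  Each
    existential axiom is proved by exhibiting such a name.  The values are the
    largest element of [A] where nothing has to be remembered; for Separation
    the value at [t] is the conjunction of [x(t)] with the formula; for Infinity
    the value of the successor of [x] at [t] is [t in x or t = x], because a
    realizer cannot decide by itself which of the two cases holds.  For
    Collection the quantifier over all names is cut down to a set by choosing,
    for each [t] in the domain of the given name and each truth value in [A],
    one name that yields this value at [t]. *)

(** * Lambda-terms in an implicative algebra *)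

Section Realizers.
Context {d : Order.disp_t} {A : implicative_algebra d}.
Implicit Types a b c p r s t : A.

Lemma meet_lb (S : set A) a : S a -> ia_meet S <= a.
Proof. by rewrite /ia_meet /bigmeet; case: cid => m /= [lb _]; exact: lb. Qed.

Lemma meet_glb (S : set A) a : (forall b, S b -> a <= b) -> a <= ia_meet S.
Proof. by rewrite /ia_meet /bigmeet; case: cid => m /= [_ ub] h; exact: ub. Qed.

Definition app a b : A := ia_meet [set c | a <= ia_imp b c].
Definition lam (f : A -> A) : A := ia_meet [set ia_imp a (f a) | a in setT].

Local Notation "s • t" := (app s t) (at level 39, left associativity).
Local Notation "'λ' x .. y , t" := (lam (fun x => .. (lam (fun y => t)) ..))
  (at level 200, x binder, y binder, right associativity).

(** Application is left adjoint to implication, because implication commutes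
    with meets on the right. *)
Lemma appP a b c : (a • b <= c) <-> (a <= ia_imp b c).
Proof.
split=> [h|h]; last exact: meet_lb.
apply: le_trans (ia_imp_mono (lexx b) h).
rewrite /app ia_imp_meet; apply: meet_glb => _ [e /= ae <-]; exact: ae.
Qed.

Lemma app_le s t a b : s <= ia_imp a b -> t <= a -> s • t <= b.
Proof.
by move=> sab ta; apply/appP; apply: le_trans sab (ia_imp_mono ta (lexx b)).
Qed.

Lemma app_mono s s' t t' : s <= s' -> t <= t' -> s • t <= s' • t'.
Proof. by move=> ss' tt'; apply: app_le tt'; apply/(le_trans ss')/appP. Qed.

Lemma beta_le f a : lam f • a <= f a.
Proof. by apply/appP/meet_lb; exists a. Qed.

(** The bound variable may be given any value below the domain of the arrow, so
    a typing judgement becomes an inequality between elements of [A] and needs no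
    typing context. *)
Lemma lam_le f a b : (forall x, x <= a -> f x <= b) -> lam f <= ia_imp a b.
Proof. by move=> fab; apply/appP/(le_trans (beta_le _ _))/fab. Qed.

Lemma le_lam s f : (forall a, s • a <= f a) -> s <= lam f.
Proof. by move=> sf; apply: meet_glb => _ [a _ <-]; apply/appP/sf. Qed.

Local Notation sep := (@ia_sep d A).

Lemma sep_app s t : sep s -> sep t -> sep (s • t).
Proof.
move=> hs; apply: ia_sep_mp; apply: ia_sep_up hs; exact/appP/lexx.
Qed.

(** * Closed terms lie in the separator *)

Fixpoint env n : Type := if n is m.+1 then (env m * A)%type else unit.

Fixpoint apps n s : env n -> A :=
  if n is m.+1 then fun e => apps s e.1 • e.2 else fun=> s.

(** The functions of [n] variables that are bounded below by an element of the
    separator applied to those variables.  Terms are built from constants of the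
    separator, variables, application and abstraction, and these preserve
    tameness by combinatory completeness; for [n = 0] tameness is membership in
    the separator. *)
Definition tame n (F : env n -> A) : Prop :=
  exists2 s, sep s & forall e, apps s e <= F e.

Let comb_K : A := ia_meet [set c | exists a b, c = ia_imp a (ia_imp b a)].
Let comb_S : A := ia_meet [set e | exists a b c,
  e = ia_imp (ia_imp a (ia_imp b c)) (ia_imp (ia_imp a b) (ia_imp a c))].

Let comb_K_le a b : comb_K • a • b <= a.
Proof. by apply/appP/appP/meet_lb; exists a, b. Qed.

Let comb_S_le a b c : comb_S • a • b • c <= (a • c) • (b • c).
Proof.
apply/appP; apply: (app_le (a := ia_imp c (b • c))); last exact/appP.
apply: (app_le (a := ia_imp c (ia_imp (b • c) ((a • c) • (b • c))))).
  by apply: meet_lb; exists c, (b • c), ((a • c) • (b • c)).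
by apply/appP; apply: (appP _ _ _).1.
Qed.

(** The constant [c] with one more variable is [K c] with that variable
    discarded. *)
Lemma tame_cst n c : sep c -> tame (fun _ : env n => c).
Proof.
elim: n c => [|n IH] c hc; first by exists c.
have [|s hs sc] := IH (comb_K • c); first exact: sep_app (ia_sep_K A) hc.
by exists s => // e; apply: le_trans (app_mono (sc _) (lexx _)) (comb_K_le _ _).
Qed.

(** The combinator [S] passes the last variable to both factors, which leaves an
    application with one variable fewer. *)
Lemma tame_app n (F G : env n -> A) :
  tame F -> tame G -> tame (fun e => F e • G e).
Proof.
elim: n F G => [|n IH] F G [s hs sF] [t ht tG].
  by exists (s • t) => [|e]; [exact: sep_app | exact: app_mono (sF e) (tG e)].
have [||r hr rS] := IH (fun e => comb_S • apps s e) (apps t).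
- by apply: IH; [exact: tame_cst (ia_sep_S A) | exists s].
- by exists t.
exists r => // e; apply: le_trans (app_mono (sF e) (tG e)).
exact: le_trans (app_mono (rS _) (lexx _)) (comb_S_le _ _ _).
Qed.

Lemma tame_lam n (F : env n.+1 -> A) :
  tame F -> tame (fun e => lam (fun a => F (e, a))).
Proof.
by case=> s hs sF; exists s => // e; apply: le_lam => a; apply: sF (e, a).
Qed.

Lemma sep_id : sep (λ x, x).
Proof.
apply: ia_sep_up (sep_app (sep_app (ia_sep_S A) (ia_sep_K A)) (ia_sep_K A)).
by apply: le_lam => a; exact: le_trans (comb_S_le _ _ _) (comb_K_le _ _).
Qed.

Lemma tame_var n : tame (fun e : env n.+1 => e.2).
Proof.
have [s hs sI] := tame_cst n sep_id.
exists s => // e; apply: le_trans (beta_le id _).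
exact: app_mono (sI _) (lexx _).
Qed.

Lemma tame_weak n (F : env n -> A) : tame F -> tame (fun e : env n.+1 => F e.1).
Proof.
move=> hF; have [s hs sF] := tame_app (tame_cst n (ia_sep_K A)) hF.
exists s => // e.
exact: le_trans (app_mono (sF e.1) (lexx _)) (comb_K_le _ _).
Qed.

Lemma sep_tame (s : A) : tame (fun _ : env 0 => s) -> sep s.
Proof. by case=> r hr /(_ tt) rs; exact: ia_sep_up rs hr. Qed.

(** * Realizers of the connectives *)

(** The connectives other than implication are second-order encodings; their
    realizers are the corresponding encodings of pairs, injections, case
    distinctions and existential witnesses. *)
Definition rpair p q : A := λ z, z • p • q.
Definition rfst p : A := p • (λ x y, x).
Definition rsnd p : A := p • (λ x y, y).
Definition rinl p : A := λ f g, f • p.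
Definition rinr p : A := λ f g, g • p.
Definition match_or p (f g : A -> A) : A := p • lam f • lam g.
Definition pack p : A := λ z, z • p.
Definition unpack p (f : A -> A) : A := p • lam f.
(** The fixed point of [f] by the combinator of Curry. *)
Definition fixp (f : A -> A) : A := (λ x, f (x • x)) • (λ x, f (x • x)).

Lemma rpair_le p q a b : p <= a -> q <= b -> rpair p q <= ia_and a b.
Proof.
move=> pa qb; apply: meet_glb => _ [c _ <-]; apply: lam_le => z zc.
exact: app_le (app_le zc pa) qb.
Qed.

Lemma rfst_le p a b : p <= ia_and a b -> rfst p <= a.
Proof.
move=> pab; apply: (app_le (a := ia_imp a (ia_imp b a))).
  by apply: le_trans pab _; apply: meet_lb; exists a.
by apply: lam_le => x xa; exact: lam_le.
Qed.

Lemma rsnd_le p a b : p <= ia_and a b -> rsnd p <= b.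
Proof.
move=> pab; apply: (app_le (a := ia_imp a (ia_imp b b))).
  by apply: le_trans pab _; apply: meet_lb; exists b.
by apply: lam_le => x xa; exact: lam_le.
Qed.

Lemma rinl_le p a b : p <= a -> rinl p <= ia_or a b.
Proof.
move=> pa; apply: meet_glb => _ [c _ <-]; apply: lam_le => f fc.
by apply: lam_le => g _; exact: app_le pa.
Qed.

Lemma rinr_le p a b : p <= b -> rinr p <= ia_or a b.
Proof.
move=> pb; apply: meet_glb => _ [c _ <-]; apply: lam_le => f _.
by apply: lam_le => g gc; exact: app_le pb.
Qed.

Lemma match_or_le p f g a b c : p <= ia_or a b ->
  (forall x, x <= a -> f x <= c) -> (forall x, x <= b -> g x <= c) ->
  match_or p f g <= c.
Proof.
move=> pab fc gc; apply: app_le (lam_le gc); apply: app_le (lam_le fc).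
by apply: le_trans pab _; apply: meet_lb; exists c.
Qed.

Lemma all_le T (I : set T) (F : T -> A) p :
  (forall i, I i -> p <= F i) -> p <= ia_all I F.
Proof. by move=> pF; apply: meet_glb => _ [i Ii <-]; exact: pF. Qed.

Lemma all_inst T (I : set T) (F : T -> A) p i :
  I i -> p <= ia_all I F -> p <= F i.
Proof. by move=> Ii /le_trans; apply; apply: meet_lb; exists i. Qed.

Lemma pack_le T (I : set T) (F : T -> A) p i :
  I i -> p <= F i -> pack p <= ia_ex I F.
Proof.
move=> Ii pF; apply: meet_glb => _ [c _ <-]; apply: lam_le => z zc.
by apply: app_le pF; apply: le_trans zc _; apply: meet_lb; exists i.
Qed.

Lemma unpack_le T (I : set T) (F : T -> A) p f c : p <= ia_ex I F ->
  (forall i x, I i -> x <= F i -> f x <= c) -> unpack p f <= c.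
Proof.
move=> pF fc; apply: (app_le (a := ia_meet [set ia_imp (F i) c | i in I])).
  by apply: le_trans pF _; apply: meet_lb; exists c.
by apply: meet_glb => _ [i Ii <-]; apply: lam_le => x; exact: fc.
Qed.

Definition ia_top : A := ia_meet set0.

Lemma top_ge p : p <= ia_top. Proof. exact: meet_glb. Qed.

(** Well-founded induction is realized by the fixed point combinator: a term
    that proves [F x] from a uniform proof of all [F y] with [y] below [x] has a
    fixed point that proves every [F x]. *)
Lemma fixp_le T (R : T -> T -> Prop) (F : T -> A) f : well_founded R ->
  (forall x r, (forall y, R y x -> r <= F y) -> f r <= F x) ->
  forall x, fixp f <= F x.
Proof.
move=> wfR h; apply: (well_founded_ind wfR) => x IH.
by apply: le_trans (beta_le _ _) _; exact: h.
Qed.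

End Realizers.

Notation "s • t" := (app s t) (at level 39, left associativity).
Notation "'λ' x .. y , t" := (lam (fun x => .. (lam (fun y => t)) ..))
  (at level 200, x binder, y binder, right associativity).

(** The tactic [realizer] proves that a term lies in the separator.  The
    variables bound on the way are the components of an environment of nested
    pairs, so that a variable reads [snd (fst ... (fst e))]; [strip] removes the
    innermost [fst], that is, the variable bound last. *)
Ltac strip d A n p :=
  let rec go q :=
    lazymatch q with
    | fun e => fst e => constr:(fun e : @env d A n => e)
    | fun e => fst (@?q' e) =>
        let r := go q' in
        let r' := eval cbv beta in (fun e : @env d A n => fst (r e)) in r'
    end in
  let r := go p in
  let r' := eval cbv beta in (fun e : @env d A n => snd (r e)) in r'.

Ltac tame_step :=
  lazymatch goal with
  | |- @tame ?d ?A ?n (fun e => lam (fun x => @?B e x)) =>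
      let G := eval cbv beta in (fun e : @env d A n.+1 => B (fst e) (snd e)) in
      refine (@tame_lam d A n G _)
  | |- @tame ?d ?A ?n (fun e => app (@?f e) (@?g e)) =>
      refine (@tame_app d A n f g _ _)
  | |- tame (fun e => snd e) => exact: tame_var
  | |- @tame ?d ?A ?n.+1 (fun e => snd (@?p e)) =>
      let r := strip d A n p in refine (@tame_weak d A n r _)
  | |- tame (fun _ => ?c) => apply: tame_cst; solve [auto with realizers]
  end.

Create HintDb realizers.
#[global] Hint Unfold rpair rfst rsnd rinl rinr match_or pack unpack fixp
  : realizers.
#[global] Hint Resolve sep_id : realizers.

Ltac realizer :=
  apply: sep_tame; autounfold with realizers; cbv beta; repeat tame_step.

(** * Names with prescribed domain and values *)

Section Names.
Context {dK dA : Order.disp_t} {K : orderType dK} {A : implicative_algebra dA}.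
Context (hK : strongly_inaccessible K).
Implicit Types (a b c : K) (D : set (W K A)).

Lemma stage_inv a (x : hset K A) : stage a x -> exists b,
  [/\ b < a, functional (graph x) & forall t, dom (graph x) t -> stage b t].
Proof.
elim=> [b {}a {}x ab fx xb|b {}a {}x _ ba _ [c [cb fx xc]]].
  by exists b; split=> //; exact: ab.1.
by exists c; split=> //; exact: lt_trans ba.
Qed.

(** The stages are cumulative.  At a successor stage of [c] the domain of [x]
    lies in a stage below that of [x], hence in the stage [c]. *)
Lemma stage_le a b : a <= b -> stage a `<=` @stage _ _ K A b.
Proof.
rewrite le_eqVlt => /orP[/eqP -> //|].
elim/(well_founded_ind (si_wf hK)): b a => b IH a ab x xa.
have [[c cb]|nsucc] := pselect (exists c, ord_succ c b).
  have [e [ea fx xe]] := stage_inv xa.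
  apply: (stage_succ cb fx) => t /xe te.
  have : e <= c := le_trans (ltW ea) (cb.2 _ ab).
  rewrite le_eqVlt => /orP[/eqP <- //|ec]; exact: (IH _ cb.1 _ ec _ te).
apply: (stage_limit _ ab xa); split=> // b0.
by have : below b a := ab; rewrite b0.
Qed.

Lemma card_lt_countable T (X : set T) : countable X -> card_lt X [set: K].
Proof.
move=> cX; split.
  apply: card_le_trans cX _; apply/infiniteP => /finite_set_countable.
  exact: si_uncountable hK.
by move=> /card_le_trans /(_ cX); exact: si_uncountable hK.
Qed.

(** A singleton is bounded, so some ordinal exceeds [a], and the least such is
    the successor. *)
Lemma ord_succ_exists a : exists b, ord_succ a b.
Proof.
have [b ab] : exists b, a < b.
  have [|b sb] := si_regular hK (X := [set a]).
    exact/card_lt_countable/finite_set_countable/finite_set1.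
  by exists b; exact: sb.
elim/(well_founded_ind (si_wf hK)): b ab => b IH ab.
have [[c [ac cb]]|least] := pselect (exists c, a < c /\ c < b).
  exact: IH _ cb ac.
exists b; split=> // c cb; rewrite leNgt; apply/negP => ac.
by apply: least; exists c.
Qed.

Definition bounded D : Prop := exists a, forall t, D t -> stage a (sval t).

Lemma W_inj (x y : W K A) : sval x = sval y -> x = y.
Proof. by case: x y => [x p] [y q] /= e; exact: eq_exist. Qed.

(** The stage that follows a bound of [D] contains all partial functions with
    domain [D], because a stage has fewer than [K] elements. *)
Lemma name_exists D (f : W K A -> A) : card_lt [set: A] [set: K] -> bounded D ->
  exists x, Wdom x = D /\ forall t, D t -> Wapp x t = f t.
Proof.
move=> hA [a Da]; have [b ab] := ord_succ_exists a.
pose F := [set p | exists2 t, D t & p = (sval t, f t)].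
have [||x xb xF] := stage_full hK hA (F := F) ab.
- by move=> t c c' [u _ [-> ->]] [u' _ [/W_inj -> ->]].
- by move=> t [c [u Du [-> _]]]; exact: Da.
pose y : W K A := exist _ x (ex_intro _ b xb).
have yD : Wdom y = D.
  apply/seteqP; split=> t; rewrite /Wdom /dom /= xF.
    by move=> [c [u Du [/W_inj -> _]]].
  by move=> Dt; exists (f t), t.
exists y; split=> // t; rewrite -yD => /Wapp_graph.
by rewrite [graph _]xF => -[u _ [/W_inj -> ->]].
Qed.

Lemma bounded_dom (x : W K A) : bounded (Wdom x).
Proof.
by have [a /stage_inv[b [_ _ xb]]] := proj2_sig x; exists b => t; exact: xb.
Qed.

Lemma bounded_set1 (x : W K A) : bounded [set x].
Proof. by have [a xa] := proj2_sig x; exists a => t ->. Qed.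

Lemma bounded_setU D D' : bounded D -> bounded D' -> bounded (D `|` D').
Proof.
move=> [a Da] [b Db]; exists (Order.max a b) => t [/Da|/Db]; apply: stage_le.
  by rewrite le_max lexx.
by rewrite le_max lexx orbT.
Qed.

Lemma bounded_dom2 (x : W K A) :
  bounded [set t | exists2 y, Wdom x y & Wdom y t].
Proof.
have [a xa] := bounded_dom x; exists a => t [y /xa /stage_inv[b [ba _ yb]] yt].
exact: (stage_le (ltW ba)) (yb _ yt).
Qed.

Lemma bounded_power (x : W K A) : bounded [set y | Wdom y `<=` Wdom x].
Proof.
have [a xa] := bounded_dom x; have [b ab] := ord_succ_exists a.
exists b => -[y ys] /= yx; have [c ya] := ys.
have [e [_ fy _]] := stage_inv ya.
apply: (stage_succ ab fy) => t yt.
have [t' e' yt'] := W_dom (x := exist _ y ys) yt.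
by rewrite -e'; exact/xa/yx.
Qed.

Lemma bounded_small D : card_lt D [set: K] -> bounded D.
Proof.
move=> sD; have /choice[rk rkP] (x : W K A) : exists a, stage a (sval x).
  by case: x => x [a xa]; exists a.
have /(si_regular hK)[a ra] : card_lt (rk @` D) [set: K].
  by apply: small_le sD; exact: card_image_le.
exists a => t Dt; apply: (stage_le _ (rkP t)); apply: ltW; apply: ra.
by exists t.
Qed.

Lemma small_dom (x : W K A) :
  card_lt [set: A] [set: K] -> card_lt (Wdom x) [set: K].
Proof.
move=> hA; have [a xa] := bounded_dom x; apply: small_le (stage_small hK hA a).
apply: (card_leI (f := fun t : W K A => sval t)) => // t t' _ _; exact: W_inj.
Qed.

End Names.

(** * Realizers of the laws of equality *)

Section Equality.
Context {dK dA : Order.disp_t} {K : orderType dK} {A : implicative_algebra dA}.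
Implicit Types (x y z t : W K A) (a b c e m p : A).

Definition rmem a e : A := pack (rpair a e).
Definition open_mem m (f : A -> A -> A) : A :=
  unpack m (fun p => f (rfst p) (rsnd p)).

Lemma rmem_le x y t a e : Wdom y t -> a <= Wapp y t -> e <= eqW t x ->
  rmem a e <= memW x y.
Proof. by move=> yt ha he; apply: pack_le yt _; exact: rpair_le. Qed.

Lemma open_mem_le x y m f c : m <= memW x y ->
  (forall t a e, Wdom y t -> a <= Wapp y t -> e <= eqW t x -> f a e <= c) ->
  open_mem m f <= c.
Proof.
move=> hm hf; apply: (unpack_le hm) => t p yt hp.
by apply: (hf t) => //; [exact: rfst_le hp | exact: rsnd_le hp].
Qed.

Lemma sub_left x y e t a :
  e <= eqW x y -> Wdom x t -> a <= Wapp x t -> rfst e • a <= memW t y.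
Proof.
rewrite eqWE => /rfst_le he xt ha.
exact: app_le (all_inst xt he) ha.
Qed.

Lemma sub_right x y e t a :
  e <= eqW x y -> Wdom y t -> a <= Wapp y t -> rsnd e • a <= memW t x.
Proof.
rewrite eqWE => /rsnd_le he yt ha.
exact: app_le (all_inst yt he) ha.
Qed.

Lemma eqW_le x y p q :
  (forall t a, Wdom x t -> a <= Wapp x t -> p • a <= memW t y) ->
  (forall t a, Wdom y t -> a <= Wapp y t -> q • a <= memW t x) ->
  rpair p q <= eqW x y.
Proof.
move=> hp hq; rewrite eqWE; apply: rpair_le; apply: all_le => t dt.
  by apply/appP/hp.
by apply/appP/hq.
Qed.

Lemma beta_le_trans (f : A -> A) a c : f a <= c -> lam f • a <= c.
Proof. exact/le_trans/beta_le. Qed.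

(** If [r] proves [t = t] for every [t] in the domain of [x], then it proves that
    each such [t] lies in [x], by the witness [t] itself. *)
Definition rrefl : A :=
  fixp (fun r => rpair (λ a, rmem a r) (λ a, rmem a r)).

Lemma sep_rrefl : ia_sep rrefl.
Proof. rewrite /rrefl /rmem; realizer. Qed.

Lemma rrefl_le x : rrefl <= eqW x x.
Proof.
apply: (fixp_le (R := fun t x => Wdom x t) (F := fun x => eqW x x)).
  exact: Wdom_wf.
by move=> {}x r IH; apply: eqW_le => t a xt ha; apply: beta_le_trans;
  exact: rmem_le xt ha (IH _ xt).
Qed.

Definition rsym e : A := rpair (rsnd e) (rfst e).

Lemma rsym_le x y e : e <= eqW x y -> rsym e <= eqW y x.
Proof.
rewrite !eqWE => he; apply: rpair_le; first exact: rsnd_le he.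
exact: rfst_le he.
Qed.

(** Transitivity of [x = y = z] by induction on [x]: from [t] in [x] one
    passes to [s] in [y] and to [u] in [z].  The induction hypothesis is about
    equalities that start from [t], so in the direction from [x] to [z] it is
    applied to the reversed equalities [t = s = u]. *)
Definition rtrans_rec : A := fixp (fun r => λ e e', rpair
  (λ a, open_mem (rfst e • a) (fun b e1 =>
    open_mem (rfst e' • b) (fun c e2 =>
      rmem c (rsym (r • rsym e1 • rsym e2)))))
  (λ c, open_mem (rsnd e' • c) (fun b e1 =>
    open_mem (rsnd e • b) (fun a e2 => rmem a (r • e2 • e1))))).

Lemma sep_rtrans_rec : ia_sep rtrans_rec.
Proof. rewrite /rtrans_rec /rmem /open_mem /rsym; realizer. Qed.

Definition rtrans e e' : A := rtrans_rec • e • e'.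

Lemma rtrans_le x y z e e' :
  e <= eqW x y -> e' <= eqW y z -> rtrans e e' <= eqW x z.
Proof.
pose F x := ia_all setT (fun p : W K A * W K A =>
  ia_imp (eqW x p.1) (ia_imp (eqW p.1 p.2) (eqW x p.2))).
suff tr : rtrans_rec <= F x.
  move=> he he'; apply: app_le he'; apply: app_le he.
  exact: (all_inst (i := (y, z)) I tr).
move: x {y z e e'}; apply: (fixp_le Wdom_wf) => x r IH.
have IHr t s u e e' : Wdom x t -> e <= eqW t s -> e' <= eqW s u ->
    r • e • e' <= eqW t u.
  move=> xt he he'; apply: app_le he'; apply: app_le he.
  exact: (all_inst (i := (s, u)) I (IH _ xt)).
apply: all_le => -[y z] _ /=; apply: lam_le => e he; apply: lam_le => e' he'.
apply: eqW_le => t a dt ha; apply: beta_le_trans.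
  apply: (open_mem_le (sub_left he dt ha)) => s b e1 ys hb he1.
  apply: (open_mem_le (sub_left he' ys hb)) => u c e2 zu hc he2.
  apply: (rmem_le zu hc); apply: rsym_le.
  exact: IHr dt (rsym_le he1) (rsym_le he2).
apply: (open_mem_le (sub_right he' dt ha)) => s b e1 ys hb he1.
apply: (open_mem_le (sub_right he ys hb)) => u c e2 xu hc he2.
by apply: (rmem_le xu hc); exact: IHr he2 he1.
Qed.

Definition mem_substl e m : A :=
  open_mem m (fun a e' => rmem a (rtrans e' e)).

Lemma mem_substl_le x x' y e m :
  e <= eqW x x' -> m <= memW x y -> mem_substl e m <= memW x' y.
Proof.
move=> he hm; apply: (open_mem_le hm) => t a e' yt ha he'.
by apply: (rmem_le yt ha); exact: rtrans_le he' he.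
Qed.

Definition mem_substr e m : A :=
  open_mem m (fun a e1 =>
    open_mem (rfst e • a) (fun b e2 => rmem b (rtrans e2 e1))).

Lemma mem_substr_le x y y' e m :
  e <= eqW y y' -> m <= memW x y -> mem_substr e m <= memW x y'.
Proof.
move=> he hm; apply: (open_mem_le hm) => t a e1 yt ha he1.
apply: (open_mem_le (sub_left he yt ha)) => s b e2 ys hb he2.
by apply: (rmem_le ys hb); exact: rtrans_le he2 he1.
Qed.

Definition mem_dom a : A := rmem a rrefl.

Lemma mem_dom_le x t a : Wdom x t -> a <= Wapp x t -> mem_dom a <= memW t x.
Proof. by move=> xt ha; apply: rmem_le xt ha (rrefl_le t). Qed.

End Equality.

#[global] Hint Unfold rmem open_mem rsym rtrans mem_substl mem_substr
  mem_dom : realizers.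
#[global] Hint Resolve sep_rrefl sep_rtrans_rec : realizers.

(** * Formulas: substitution of equals and renaming *)

Section Formulas.
Context {dK dA : Order.disp_t} {K : orderType dK} {A : implicative_algebra dA}.
Implicit Types (x y z t : W K A) (a b c e m : A).

Lemma beta2_le (f : A -> A -> A) a b : (λ a b, f a b) • a • b <= f a b.
Proof.
exact: le_trans (app_mono (beta_le _ _) (lexx _)) (beta_le _ _).
Qed.

(** One realizer transports the value of [p] along any equality in the
    coordinate [k].  The other coordinates keep their values, so that under a
    binder the new variable needs no equality.  In the premise of an implication
    the equality is reversed. *)
Lemma interp_subst n (p : form n) (k : 'I_n) :
  exists2 s : A, ia_sep s & forall (v v' : n.-tuple (W K A)) e m,
    (forall i, i != k -> tnth v i = tnth v' i) ->
    e <= eqW (tnth v k) (tnth v' k) -> m <= interp p v ->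
    s • e • m <= interp p v'.
Proof.
have up l (u u' : l.-tuple (W K A)) (j : 'I_l) (b : W K A) :
    (forall i, i != j -> tnth u i = tnth u' i) ->
    forall i, i != lift ord0 j ->
      tnth [tuple of b :: u] i = tnth [tuple of b :: u'] i.
  move=> uu' i; case: (unliftP ord0 i) => [i' ->|-> //].
  by rewrite (inj_eq lift_inj) !tnthS; exact: uu'.
elim: p k => {n} [n i j|n i j|n|n p IHp q IHq|n p IHp q IHq|n p IHp q IHq
  |n p IHp|n p IHp] k /=.
- pose l e m := if i == k then mem_substl e m else m.
  pose r e m := if j == k then mem_substr e m else m.
  exists (λ e m, r e (l e m)).
    by rewrite /r /l; case: (i == k); case: (j == k); realizer.
  move=> v v' e m vv' he hm; apply: le_trans (beta2_le _ _ _) _.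
  have hl : l e m <= memW (tnth v' i) (tnth v j).
    rewrite /l; case: eqVneq => [ik|/vv' <- //].
    by rewrite ik in hm *; exact: mem_substl_le he hm.
  rewrite /r; case: eqVneq => [jk|/vv' <- //].
  by rewrite jk in hl *; exact: mem_substr_le he hl.
- pose l e m := if i == k then rtrans (rsym e) m else m.
  pose r e m := if j == k then rtrans m e else m.
  exists (λ e m, r e (l e m)).
    by rewrite /r /l; case: (i == k); case: (j == k); realizer.
  move=> v v' e m vv' he hm; apply: le_trans (beta2_le _ _ _) _.
  have hl : l e m <= eqW (tnth v' i) (tnth v j).
    rewrite /l; case: eqVneq => [ik|/vv' <- //].
    by rewrite ik in hm *; exact: rtrans_le (rsym_le he) hm.
  rewrite /r; case: eqVneq => [jk|/vv' <- //].
  by rewrite jk in hl *; exact: rtrans_le hl he.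
- exists (λ e m, m); first by realizer.
  by move=> v v' e m _ _ hm; exact: le_trans (beta2_le _ _ _) hm.
- have [s hs sP] := IHp k; have [t ht tP] := IHq k.
  exists (λ e m, rpair (s • e • rfst m) (t • e • rsnd m)); first by realizer.
  move=> v v' e m vv' he hm; apply: le_trans (beta2_le _ _ _) _.
  apply: rpair_le; first exact: sP vv' he (rfst_le hm).
  exact: tP vv' he (rsnd_le hm).
- have [s hs sP] := IHp k; have [t ht tP] := IHq k.
  exists (λ e m, match_or m (fun a => rinl (s • e • a))
                            (fun b => rinr (t • e • b))).
    by realizer.
  move=> v v' e m vv' he hm; apply: le_trans (beta2_le _ _ _) _.
  apply: (match_or_le hm) => a ha; first exact/rinl_le/(sP _ _ _ _ vv' he ha).
  exact/rinr_le/(tP _ _ _ _ vv' he ha).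
- have [s hs sP] := IHp k; have [t ht tP] := IHq k.
  exists (λ e m a, t • e • (m • (s • rsym e • a))); first by realizer.
  move=> v v' e m vv' he hm; apply: le_trans (beta2_le _ _ _) _.
  apply: lam_le => a ha; apply: (tP _ _ _ _ vv' he); apply: app_le hm _.
  by apply: sP (rsym_le he) ha => i /vv' ->.
- have [s hs sP] := IHp (lift ord0 k).
  exists (λ e m, unpack m (fun a => pack (s • e • a))); first by realizer.
  move=> v v' e m vv' he hm; apply: le_trans (beta2_le _ _ _) _.
  apply: (unpack_le hm) => b a _ ha; apply: (pack_le (i := b)) => //.
  apply: sP ha; last by rewrite !tnthS.
  exact: up vv'.
- have [s hs sP] := IHp (lift ord0 k); exists s => // v v' e m vv' he hm.
  apply: all_le => b _.
  apply: sP (all_inst (i := b) I hm); last by rewrite !tnthS.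
  exact: up vv'.
Qed.

Lemma interp_subst0 n (p : form n.+1) :
  exists2 s : A, ia_sep s & forall (v : n.-tuple (W K A)) x x' e m,
    e <= eqW x x' -> m <= interp p [tuple of x :: v] ->
    s • e • m <= interp p [tuple of x' :: v].
Proof.
have [s hs sP] := interp_subst p ord0; exists s => // v x x' e m he.
apply: sP => [i|]; last by rewrite !tnth0.
by case: (unliftP ord0 i) => [j ->|-> //]; rewrite !tnthS.
Qed.

Lemma tnth_fscons (m n : nat) (v : m.-tuple (W K A)) (v' : n.-tuple (W K A))
    i0 f x :
  tnth v i0 = x -> (forall i, tnth v (f i) = tnth v' i) ->
  forall i, tnth v (fscons i0 f i) = tnth [tuple of x :: v'] i.
Proof.
move=> vx vf i; rewrite /fscons; case: unliftP => [j ->|-> //].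
by rewrite tnthS vf.
Qed.

Lemma interp_frename n (p : form n) (m : nat) (f : 'I_n -> 'I_m)
    (v : m.-tuple (W K A)) (v' : n.-tuple (W K A)) :
  (forall i, tnth v (f i) = tnth v' i) ->
  interp (frename p f) v = interp p v'.
Proof.
have up k l (g : 'I_k -> 'I_l) (u : l.-tuple (W K A)) (u' : k.-tuple (W K A))
    (b : W K A) :
    (forall i, tnth u (g i) = tnth u' i) ->
    forall i, tnth [tuple of b :: u] (fup g i) = tnth [tuple of b :: u'] i.
  by move=> gu; apply: tnth_fscons => // i; rewrite tnthS.
elim: p m f v v' => {n} [n i j|n i j|n|n p IHp q IHq|n p IHp q IHq|n p IHp q IHq
  |n p IHp|n p IHp] m f v v' fv /=.
- by rewrite !fv.
- by rewrite !fv.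
- by [].
- by rewrite (IHp _ _ _ v') // (IHq _ _ _ v').
- by rewrite (IHp _ _ _ v') // (IHq _ _ _ v').
- by rewrite (IHp _ _ _ v') // (IHq _ _ _ v').
- by congr (ia_ex _ _); apply/funext => b; apply: IHp; exact: up.
- by congr (ia_all _ _); apply/funext => b; apply: IHp; exact: up.
Qed.

Definition realized n (p : form n) : Prop :=
  exists2 s : A, ia_sep s & forall v : n.-tuple (W K A), s <= interp p v.

Lemma models_closure n (p : form n) :
  realized p -> models K A (Defs.fclosure p).
Proof.
elim: n p => [|n IH] p [s hs sp].
  exact: ia_sep_up (sp _) hs.
by apply: IH; exists s => // v; apply: all_le.
Qed.

End Formulas.

(** * The axioms *)

Section IZF.
Context {dK dA : Order.disp_t} {K : orderType dK} {A : implicative_algebra dA}.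
Context (hK : strongly_inaccessible K) (hA : card_lt [set: A] [set: K]).
Implicit Types (a b c e m : A).
Local Notation W := (W K A).

Let name D (f : W -> A) : bounded D ->
  exists x, Wdom x = D /\ forall t, D t -> Wapp x t = f t.
Proof. exact: name_exists. Qed.

Let set_name D : bounded D ->
  exists x : W, Wdom x = D /\ forall t a, D t -> a <= Wapp x t.
Proof.
move=> /(name (fun=> ia_top))[x [xD xf]]; exists x; split=> // t a /xf ->.
exact: top_ge.
Qed.

Let rid : A := λ a, a.

Let rmem_top : A := rmem rid rrefl.

Lemma models_Emp : models K A axEmp.
Proof.
apply: (ia_sep_up (a := pack (λ m, unpack m (fun a => a)))); last by realizer.
have [|x [xD _]] := @set_name set0.
  by apply: bounded_small => //; exact/card_lt_countable/countable0.
apply: (pack_le (i := x)) => //=; apply: all_le => t _; apply: lam_le => m hm.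
by apply: (unpack_le hm) => s a; rewrite [Wdom _]xD.
Qed.

Lemma models_Ext : models K A axExt.
Proof.
pose r := λ h : A, rpair (λ a, rfst h • mem_dom a) (λ a, rsnd h • mem_dom a).
apply: (ia_sep_up (a := r)); last by rewrite /r; realizer.
rewrite /models /=; apply: all_le => x _; apply: all_le => y _.
apply: lam_le => h hh.
apply: eqW_le => t a dt ha; apply: beta_le_trans.
  exact: app_le (all_inst (i := t) I (rfst_le hh)) (mem_dom_le dt ha).
exact: app_le (all_inst (i := t) I (rsnd_le hh)) (mem_dom_le dt ha).
Qed.

Lemma models_Pair : models K A axPair.
Proof.
pose r : A := pack (rpair rmem_top rmem_top).
apply: (ia_sep_up (a := r)); last by rewrite /r /rmem_top; realizer.
rewrite /models /=; apply: all_le => x _; apply: all_le => y _.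
have [|z [zD zt]] := @set_name ([set x] `|` [set y]).
  by apply: (bounded_setU hK); exact: bounded_set1.
apply: (pack_le (i := z)) => //=; apply: rpair_le.
  have Dx : ([set x] `|` [set y]) x by left.
  by apply: (rmem_le (t := x)) (rrefl_le _); rewrite /= ?zD //; exact: zt.
have Dy : ([set x] `|` [set y]) y by right.
by apply: (rmem_le (t := y)) (rrefl_le _); rewrite /= ?zD //; exact: zt.
Qed.

Lemma models_Union : models K A axUnion.
Proof.
pose r : A := pack (λ m m', open_mem m (fun a e =>
  open_mem (mem_substr (rsym e) m') (fun b e' => rmem rid e'))).
apply: (ia_sep_up (a := r)); last by rewrite /r; realizer.
rewrite /models /=; apply: all_le => x _.
have [u [uD ut]] := set_name (bounded_dom2 hK x).
apply: (pack_le (i := u)) => //=; apply: all_le => y _; apply: lam_le => m hm.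
apply: all_le => z _; apply: lam_le => m' hm'.
apply: (open_mem_le hm) => t a e xt ha he.
apply: (open_mem_le (mem_substr_le (rsym_le he) hm')) => s b e' ts hb he'.
have Ds : [set s | exists2 t, Wdom x t & Wdom t s] s by exists t.
by apply: (rmem_le _ _ he') => /=; [rewrite uD | exact: ut].
Qed.

(** A subset [y] of [x] need not have its domain inside that of [x].  It is
    equal to the name with the domain of [x] whose value at [t] is [t in y], and
    the names with domain inside that of [x] form a bounded set. *)
Lemma models_Pow : models K A axPow.
Proof.
pose r : A := pack (λ h, rmem rid (rpair (λ a, a)
  (λ b, open_mem (h • mem_dom b) (fun c e =>
     rmem (mem_substl (rsym e) (mem_dom b)) e)))).
apply: (ia_sep_up (a := r)); last by rewrite /r; realizer.
rewrite /models /=; apply: all_le => x _.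
have [z [zD zt]] := set_name (bounded_power hK x).
apply: (pack_le (i := z)) => //=; apply: all_le => y _; apply: lam_le => h hh.
have [y' [yD yt]] := name (fun t => memW t y) (bounded_dom x).
have Dy' : [set y | Wdom y `<=` Wdom x] y' by rewrite /= yD.
apply: (rmem_le (t := y')) => /=; [by rewrite zD | exact: zt |].
apply: eqW_le => t a dt ha; apply: beta_le_trans.
  by rewrite -[memW _ _]yt // -yD.
have hm := app_le (all_inst (i := t) I hh) (mem_dom_le dt ha).
apply: (open_mem_le hm) => s c e xs hc he.
apply: (rmem_le _ _ he); first by rewrite yD.
by rewrite yt //; exact: mem_substl_le (rsym_le he) (mem_dom_le dt ha).
Qed.

(** The numerals have values that carry the case distinction between [t in x]
    and [t = x] at the successor of [x]: the realizer of the last clause is the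
    same for all numerals, and could not decide it. *)
Lemma models_Inf : models K A axInf.
Proof.
pose r : A := pack (rpair
  (pack (rpair rmem_top (λ m, unpack m (fun a => a))))
  (λ m, open_mem m (fun a e => pack (rpair rmem_top (rpair
    (λ m', open_mem (mem_substr (rsym e) m')
       (fun b e' => rmem (rinl (mem_dom b)) e'))
    (rpair (rmem (rinr rrefl) e)
      (λ m', open_mem m' (fun b e' => match_or b
         (fun c => rinl (mem_substr e (mem_substl e' c)))
         (fun c => rinr (rtrans (rsym e') (rtrans c e))))))))))).
apply: (ia_sep_up (a := r)); last by rewrite /r /rmem_top; realizer.
have [|x0 [x0D _]] := @set_name set0.
  by apply: bounded_small => //; exact/card_lt_countable/countable0.
have /choice[succ succP] (x : W) : exists y : W, Wdom y = Wdom x `|` [set x] /\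
    forall t, (Wdom x `|` [set x]) t -> Wapp y t = ia_or (memW t x) (eqW t x).
  apply: name; apply: (bounded_setU hK); first exact: bounded_dom.
  exact: bounded_set1.
pose num n := iter n succ x0.
have [|u [uD ut]] := @set_name (range num).
  apply/bounded_small/card_lt_countable => //.
  exact: sub_countable (card_image_le _ _) _.
have num_mem n e x : e <= eqW (num n) x -> rmem rid e <= memW x u.
  have Dn : range num (num n) by exists n.
  by move=> he; apply: rmem_le he; [rewrite uD | exact: ut].
rewrite /models /=; apply: (pack_le (i := u)) => //=; apply: rpair_le.
  apply: (pack_le (i := x0)) => //=; apply: rpair_le.
    exact: (@num_mem 0) (rrefl_le _).
  apply: all_le => t _; apply: lam_le => m hm.
  by apply: (unpack_le hm) => s a; rewrite [Wdom _]x0D.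
apply: all_le => x _; apply: lam_le => m hm; apply: (open_mem_le hm) => nx a e.
rewrite [Wdom _]uD => -[n _ <-] _ he {nx}.
have [yD yt] := succP (num n); set y := succ _ in yD yt.
apply: (pack_le (i := y)) => //=; apply: rpair_le.
  exact: (@num_mem n.+1) (rrefl_le _).
apply: rpair_le.
  apply: all_le => z _; apply: lam_le => m' hm'.
  apply: (open_mem_le (mem_substr_le (rsym_le he) hm')) => t b e' nt hb he'.
  have Dt : (Wdom (num n) `|` [set num n]) t by left.
  apply: (rmem_le _ _ he'); rewrite /= ?yD // yt //.
  exact/rinl_le/mem_dom_le.
apply: rpair_le.
  have Dn : (Wdom (num n) `|` [set num n]) (num n) by right.
  by apply: (rmem_le _ _ he); rewrite /= ?yD // yt //; exact/rinr_le/rrefl_le.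
apply: all_le => z _; apply: lam_le => m' hm'.
apply: (open_mem_le hm') => t b e'; rewrite [Wdom _]yD => Dt.
rewrite [Wapp _ _]yt // => hb he'; apply: (match_or_le hb) => c hc.
  exact/rinl_le/(mem_substr_le he)/(mem_substl_le he').
exact/rinr_le/(rtrans_le (rsym_le he'))/(rtrans_le hc).
Qed.

Lemma models_Sep n (p : form n.+2) : models K A (axSep p).
Proof.
apply: models_closure; have [s hs sP] := interp_subst0 (K := K) (A := A) p.
exists (pack (rpair
  (λ m, open_mem m (fun a e => rpair (rmem (rfst a) e) (s • e • rsnd a)))
  (λ m b, open_mem m (fun a e => rmem (rpair a (s • rsym e • b)) e)))).
  by realizer.
move=> w /=; apply: all_le => x _.
pose F z : A := interp p [tuple of z :: [tuple of x :: w]].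
have [y [yD yt]] := name (fun t => ia_and (Wapp x t) (F t)) (bounded_dom x).
apply: (pack_le (i := y)) => //; apply: all_le => z0 _.
have pE z : interp (frename p (fscons (@fvar n.+4 0 isT)
      (fscons (@fvar n.+4 3 isT) (@rshift 4 n))))
    [tuple of z :: [tuple of z0 :: [tuple of y :: [tuple of x :: w]]]] = F z.
  apply: interp_frename; apply: tnth_fscons => //; apply: tnth_fscons => // i.
  by rewrite !(tnth_nth z).
apply: rpair_le; apply: all_le => z _; apply: lam_le => m hm; rewrite /= ?pE.
  apply: (open_mem_le hm) => t a e; rewrite [Wdom _]yD => xt.
  rewrite [Wapp _ _]yt // => ha he; apply: rpair_le.
    exact: rmem_le xt (rfst_le ha) he.
  exact: sP he (rsnd_le ha).
apply: lam_le => b hb; apply: (open_mem_le hm) => t a e xt ha he.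
apply: (rmem_le (t := t) _ _ he); first by rewrite [Wdom _]yD.
by rewrite [Wapp _ _]yt //; apply: rpair_le => //; exact: sP (rsym_le he) hb.
Qed.

(** The hypothesis of induction quantifies over the [y] with [y in x]; such a [y]
    is equal to some [t] in the domain of [x], and the formula is transported
    from [t] to [y]. *)
Lemma models_Ind n (p : form n.+1) : models K A (axInd p).
Proof.
apply: models_closure; have [s hs sP] := interp_subst0 (K := K) (A := A) p.
exists (λ h, fixp (fun r =>
    h • (λ m, open_mem m (fun a e => s • e • r)))); first by realizer.
move=> w /=; apply: lam_le => h hh; apply: all_le => x _; move: x.
apply: (fixp_le Wdom_wf) => x r IH.
apply: app_le (all_inst (i := x) I hh) _.
apply: all_le => y _; apply: lam_le => m hm.
rewrite (interp_frename p (v' := [tuple of y :: w])).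
  by apply: (open_mem_le hm) => t a e xt _ he; exact: sP he (IH _ xt).
by apply: tnth_fscons => // i; rewrite !(tnth_nth y).
Qed.

(** For [t] in the domain of [y] the truth values of [p] at [t] and [z] form a
    subset of [A], so a set of at most as many names [z] as there are pairs
    [(t, a)] attains them all; this set is bounded, and [u] is the name whose
    domain it is. *)
Lemma models_Col n (p : form n.+3) : models K A (axCol p).
Proof.
apply: models_closure.
have [s hs sP] := interp_subst (K := K) (A := A) p (@fvar n.+3 2 isT).
exists (λ h, pack (λ m, open_mem m (fun a e =>
    unpack (h • mem_dom a) (fun b => pack (rpair rmem_top (s • e • b)))))).
  by rewrite /rmem_top; realizer.
move=> w /=; apply: all_le => y _; apply: lam_le => h hh.
pose v x z := [tuple of z :: [tuple of y :: [tuple of x :: w]]].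
pose F x z : A := interp p (v x z).
have /choice[g gP] (ta : W * A) :
    exists z, (exists z', F ta.1 z' = ta.2) -> F ta.1 z = ta.2.
  have [[z' e]|nz] := pselect (exists z', F ta.1 z' = ta.2); first by exists z'.
  by exists y.
pose D := g @` [set ta | Wdom y ta.1 /\ [set: A] ta.2].
have [|u [uD ut]] := @set_name D.
  apply: bounded_small => //; apply: small_le (card_image_le _ _) _.
  by apply: small_prod => //; exact: small_dom.
apply: (pack_le (i := u)) => //=; apply: all_le => x _; apply: lam_le => m hm.
apply: (open_mem_le hm) => t a e yt ha he.
have := app_le (all_inst (i := t) I hh) (mem_dom_le yt ha).
move=> /unpack_le; apply => z b _ hb.
pose z' := g (t, F t z).
have {}hb : b <= F t z'.
  have -> : F t z' = F t z by apply: (gP (t, F t z)); exists z.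
  move: hb; rewrite (interp_frename p (v' := v t z)) //.
  by do 3!apply: tnth_fscons => //; move=> i; rewrite !(tnth_nth z).
have Dz : D z' by exists (t, F t z).
apply: (pack_le (i := z')) => //; apply: rpair_le.
  by apply: (rmem_le (t := z')) (rrefl_le _); rewrite /= ?uD //; exact: ut.
rewrite (interp_frename p (v' := v x z')); last first.
  by do 3!apply: tnth_fscons => //; move=> i; rewrite !(tnth_nth z).
apply: sP hb => // i.
by do 3![case: (unliftP ord0 i) => [{}i ->|-> //]; rewrite !tnthS].
Qed.

End IZF.

Theorem mainTheorem1 (dK dA : Order.disp_t) (K : orderType dK)
  (A : implicative_algebra dA)
  (hK : strongly_inaccessible K)
  (hA : card_lt (@setT A) (@setT K)) :
  forall s : form 0, IZF s -> models K A s.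
Proof.
move=> s [||||||n p|n p|n p].
- exact: models_Emp.
- exact: models_Ext.
- exact: models_Pair.
- exact: models_Union.
- exact: models_Pow.
- exact: models_Inf.
- exact: models_Sep.
- exact: models_Col.
- exact: models_Ind.
Qed.
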